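(* Let $\mathcal M(2)$ be a Möbius plane of order $2$. Then $\mu(\mathcal M(2))=4$.
   Context: A Möbius plane is a pair $(\mathcal P,\mathcal Z)$, where $\mathcal P$ is a set (of points) and $\mathcal Z$ is a set of subsets of $\mathcal P$ (circles), such that: (i) any three pairwise distinct points lie on exactly one circle; (ii) if $z\in\mathcal Z$, $P\in z$ and $Q\in\mathcal P\setminus z$, there is exactly one circle $z'$ through $P$ and $Q$ with $z\cap z'=\{P\}$; (iii) there is at least one circle and every circle has at least three points; (iv) for every circle $z$ there is a point not on $z$. A finite Möbius plane has order $q$ if every circle has $q+1$ points. The point-circle incidence graph $G$ has vertex set $V=\mathcal P\cup\mathcal Z$ and edges $\{P,z\}$ with $P\in z$, with shortest-path distance $d$. A set $S\subseteq V$ is a resolving set if for any two distinct $u,v\in V$ there is $s\in S$ with $d(u,s)\ne d(v,s)$; $\mu(\mathcal M(2))$ is the minimum cardinality of a resolving set of $G$. *)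

(* Defs.v *)
From mathcomp Require Import all_boot.
Set Implicit Arguments.
Unset Strict Implicit.
Unset Printing Implicit Defensive.

Definition mobius_plane (T : finType) (Z : {set {set T}}) : Prop :=
  [/\ forall P Q R : T, P != Q -> P != R -> Q != R ->
        exists! z : {set T}, [/\ z \in Z, P \in z, Q \in z & R \in z],
      forall (z : {set T}) (P Q : T), z \in Z -> P \in z -> Q \notin z ->
        exists! z' : {set T},
          [/\ z' \in Z, P \in z', Q \in z' & z :&: z' = [set P]],
      (exists z : {set T}, z \in Z) /\ (forall z : {set T}, z \in Z -> 3 <= #|z|)
    & forall z : {set T}, z \in Z -> exists Q : T, Q \notin z].

Definition mobius_order (T : finType) (Z : {set {set T}}) (q : nat) : Prop :=
  forall z : {set T}, z \in Z -> #|z| = q.+1.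

Section Graph.
Variables (V : finType) (e : rel V).

Definition walk_of_length (x y : V) (n : nat) : bool :=
  [exists p : n.-tuple V, path e x p && (last x p == y)].

(* A shortest walk has length less than #|V|; the value #|V| is returned
   exactly when y is not reachable from x. *)
Definition gdist (x y : V) : nat := find (walk_of_length x y) (iota 0 #|V|).

Definition resolving (S : {set V}) : bool :=
  [forall u, forall v, (u != v) ==> [exists s in S, gdist u s != gdist v s]].

(* The default value setT is legitimate: see resolvingT. *)
Definition metric_dimension : nat :=
  #|[arg min_(S < [set: V] | resolving S) #|S|]|.

Lemma gdist_eq0 (x y : V) : (gdist x y == 0) = (x == y).
Proof.
rewrite /gdist; have : 0 < #|V| by apply/card_gt0P; exists x.
case: #|V| => //= n _.
have -> : walk_of_length x y 0 = (x == y).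
  apply/existsP/idP => [[p]|xy]; first by rewrite tuple0.
  by exists [tuple].
by case: (x == y).
Qed.

Lemma resolvingT : resolving [set: V].
Proof.
apply/forallP=> u; apply/forallP=> v; apply/implyP=> neq_uv.
apply/existsP; exists u; rewrite inE /=; apply: contraNneq neq_uv => duv.
by rewrite eq_sym -gdist_eq0 -duv gdist_eq0.
Qed.

Lemma metric_dimensionP (k : nat) :
  metric_dimension = k <->
    (exists2 S : {set V}, resolving S & #|S| = k) /\
    (forall S : {set V}, resolving S -> k <= #|S|).
Proof.
rewrite /metric_dimension; case: arg_minnP => [|S0 res0 min0].
  exact: resolvingT.
split=> [<-|[[S resS <-] minS]]; first by split=> //; exists S0.
by apply/eqP; rewrite eqn_leq min0 // minS.
Qed.

End Graph.

Definition incidence_vertex (T : finType) (Z : {set {set T}}) : finType :=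
  (T + {z : {set T} | z \in Z})%type.

Definition incidence (T : finType) (Z : {set {set T}}) :
    rel (incidence_vertex Z) :=
  fun u v => match u, v with
  | inl P, inr z => P \in val z
  | inr z, inl P => P \in val z
  | _, _ => false
  end.

(* Main.v *)
Require Import Defs.
From mathcomp Require Import all_boot.

(** In order 2 every circle is a triple of points; a sixth point would
    contradict the uniqueness of tangent circles, so there are exactly five
    points and the circles are all ten triples.  Two distinct circles always
    meet, hence lie at distance 2, so a circle outside a resolving set with [a]
    points and [b] circles is determined by its trace on the [a] points.  Thus
    [10 - b <= 2 ^ a], which forces [a + b >= 4].  Conversely, any four of the
    five points resolve the graph. *)

(** * Walks of prescribed length and graph distance *)

Section GraphDistance.
Variables (V : finType) (e : rel V).
Implicit Types x y : V.

Lemma walk_of_length0 x y : walk_of_length e x y 0 = (x == y).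
Proof.
apply/existsP/idP => [[p]|xy]; first by rewrite tuple0.
by exists [tuple].
Qed.

Lemma walk_of_lengthS x y n :
  walk_of_length e x y n.+1 = [exists z, e x z && walk_of_length e z y n].
Proof.
apply/existsP/existsP => [[p]|[z /andP[exz /existsP[p zpy]]]].
  case/tupleP: p => z p /= /andP[/andP[exz zp] py].
  by exists z; rewrite exz; apply/existsP; exists p; rewrite zp.
by exists [tuple of z :: p]; rewrite /= exz.
Qed.

Lemma walk_of_length1 x y : walk_of_length e x y 1 = e x y.
Proof.
rewrite walk_of_lengthS; apply/existsP/idP => [[z]|exy].
  by rewrite walk_of_length0 => /andP[exz /eqP <-].
by exists y; rewrite exy walk_of_length0 /=.
Qed.

Lemma gdist_eq1 x y : 1 < #|V| -> (gdist e x y == 1) = (x != y) && e x y.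
Proof.
rewrite /gdist; case: #|V| => [|[|n]] //= _.
rewrite walk_of_length0 walk_of_length1.
by case: (x == y) => //=; case: (e x y).
Qed.

(** [gdist] tries only the lengths below [#|V|], hence the bound on [n]. *)
Lemma gdist_first_walk x y n : n < #|V| -> walk_of_length e x y n ->
  (forall m, m < n -> ~~ walk_of_length e x y m) -> gdist e x y = n.
Proof.
move=> ltnV wn min_n; rewrite /gdist.
have has_w : has (walk_of_length e x y) (iota 0 #|V|).
  by apply/hasP; exists n; rewrite ?mem_iota.
have lt_f : find (walk_of_length e x y) (iota 0 #|V|) < #|V|.
  by rewrite -[X in _ < X](size_iota 0) -has_find.
have := nth_find 0 has_w; rewrite nth_iota // add0n => wf.
case: (ltngtP (find (walk_of_length e x y) (iota 0 #|V|)) n) => // [/min_n|].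
  by rewrite wf.
by move/(before_find 0); rewrite nth_iota // add0n wn.
Qed.

End GraphDistance.

(** * Points and circles of a plane of order 2 *)

Section OrderTwo.
Variables (T : finType) (Z : {set {set T}}).
Hypotheses (hM : mobius_plane Z) (h2 : mobius_order Z 2).

(** A triple is contained in the circle through its three points, and equal cardinality makes the
    two coincide. *)
Lemma mem_circle_order2 (z : {set T}) : (z \in Z) = (#|z| == 3).
Proof.
apply/idP/eqP => [/h2//|z3]; case: hM => circ _ _ _.
have [P Pz] : exists P, P \in z by apply/card_gt0P; rewrite z3.
have := cardsD1 P z; rewrite z3 Pz add1n => -[z2].
have [Q Qz] : exists Q, Q \in z :\ P by apply/card_gt0P; rewrite -z2.
have := cardsD1 Q (z :\ P); rewrite -z2 Qz add1n => -[z1].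
have [R Rz] : exists R, R \in z :\ P :\ Q by apply/card_gt0P; rewrite -z1.
have := cardsD1 R (z :\ P :\ Q); rewrite -z1 Rz add1n => -[/esym/cards0_eq z0].
move: Qz Rz; rewrite !inE => /andP[QP Qz] /and3P[RQ RP Rz].
have [|||w [[wZ Pw Qw Rw] _]] := circ P Q R; rewrite 1?eq_sym //.
suff -> : z = w by [].
apply/eqP; rewrite eqEcard z3 (h2 _ wZ) leqnn andbT.
apply/subsetP => x xz; have : x \notin z :\ P :\ Q :\ R by rewrite z0 inE.
rewrite !inE xz andbT !negb_and !negbK.
by case/or3P => /eqP ->.
Qed.

(** Two circles tangent at a point cover 3 + 3 - 1 = 5 points. The existence of a tangent circle
    provides these, and its uniqueness excludes any other. *)
Lemma card_points_order2 : #|T| = 5.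
Proof.
case: hM => _ tang [[z zZ] _] out; have [Q Qz] := out z zZ.
have [P Pz] : exists P, P \in z by apply/card_gt0P; rewrite (h2 _ zZ).
have [w [[wZ Pw Qw zw] uniq_w]] := tang z P Q zZ Pz Qz.
have czw : #|z :|: w| = 5 by rewrite cardsU (h2 _ zZ) (h2 _ wZ) zw cards1.
rewrite -czw -cardsT; apply: eq_card => S; rewrite in_setT; apply/esym.
apply: contraT => /[!inE]; rewrite negb_or => /andP[Sz Sw].
(* Both w and {P, Q, S} touch z at P and pass through Q. *)
have PQ : P != Q by apply: contraNneq Qz => <-.
have PS : P != S by apply: contraNneq Sz => <-.
have QS : Q != S by apply: contraNneq Sw => <-.
have /uniq_w w_eq : [/\ [set P; Q; S] \in Z, P \in [set P; Q; S],
    Q \in [set P; Q; S] & z :&: [set P; Q; S] = [set P]].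
  split; rewrite ?inE ?eqxx ?orbT //.
    rewrite mem_circle_order2 -setUA cardsU1 cards2 !inE.
    by rewrite negb_or PQ PS QS.
  apply/setP => x; rewrite !inE.
  case: (eqVneq x P) => [->|_]; first by rewrite Pz.
  case: (eqVneq x Q) => [->|_]; first by rewrite (negPf Qz).
  by case: (eqVneq x S) => [->|_]; rewrite ?(negPf Sz) ?andbF.
by move: Sw; rewrite w_eq !inE eqxx orbT.
Qed.

Lemma card_circles_order2 : #|Z| = 10.
Proof.
have -> : Z = [set z : {set T} | #|z| == 3].
  by apply/setP => z; rewrite mem_circle_order2 inE.
by rewrite card_draws card_points_order2.
Qed.

(** * Distances and resolving sets in the incidence graph *)

Notation V := (incidence_vertex Z).
Notation circle := {z : {set T} | z \in Z}.
Notation dist := (gdist (@incidence T Z)).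

Lemma card_incidence_vertex_order2 : #|V| = 15.
Proof.
by rewrite card_sum card_points_order2 card_sig card_circles_order2.
Qed.

(** Two disjoint triples would need six points. *)
Lemma circles_meet (z w : circle) : exists P, P \in val z :&: val w.
Proof.
apply/card_gt0P; have := cardsU (val z) (val w).
rewrite (h2 _ (valP z)) (h2 _ (valP w)) => cU.
have : #|val z :|: val w| <= 5 by rewrite -card_points_order2 max_card.
by rewrite cU; case: #|_|.
Qed.

Lemma gdist_circles (z w : circle) : z != w -> dist (inr z : V) (inr w) = 2.
Proof.
move=> zw; have [P /setIP[Pz Pw]] := circles_meet z w.
apply: gdist_first_walk; first by rewrite card_incidence_vertex_order2.
  rewrite walk_of_lengthS; apply/existsP; exists (inl P).
  by rewrite walk_of_length1 /= Pz Pw.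
by case=> [|[|//]] _; rewrite ?walk_of_length0 ?walk_of_length1.
Qed.

Lemma gdist_circle_point (z : circle) (P : T) :
  dist (inr z : V) (inl P) = if P \in val z then 1 else 3.
Proof.
case: ifPn => Pz.
  by apply/eqP; rewrite gdist_eq1 ?card_incidence_vertex_order2 //=.
have [A Az] : exists A, A \in val z by apply/card_gt0P; rewrite (h2 _ (valP z)).
(* Exchanging [A] for [P] in [z] gives another triple, hence a circle [w] through [P]. It meets [z]
   in some [B], and [z], [B], [w], [P] is a walk of length 3. *)
have wZ : P |: val z :\ A \in Z.
  rewrite mem_circle_order2 cardsU1 !inE (negPf Pz) andbF.
  by have := cardsD1 A (val z); rewrite Az (h2 _ (valP z)) add1n => -[<-].
pose w : circle := exist (fun z => z \in Z) _ wZ.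
have [B] := circles_meet z w.
rewrite in_setI => /andP[Bz Bw].
apply: gdist_first_walk; first by rewrite card_incidence_vertex_order2.
  rewrite walk_of_lengthS; apply/existsP; exists (inl B).
  rewrite walk_of_lengthS /= Bz; apply/existsP; exists (inr w).
  by rewrite walk_of_length1; apply/andP; split=> //=; rewrite !inE eqxx.
case=> [|[|[|//]]] _; rewrite ?walk_of_length0 ?walk_of_length1 //.
(* Length 2 is impossible: the graph is bipartite, so such a walk from a circle ends at a circle. *)
rewrite walk_of_lengthS; apply/existsP => -[[Q|x]] //.
by rewrite walk_of_length1 andbF.
Qed.

Lemma resolving_order2_ge4 (S : {set V}) :
  resolving (@incidence T Z) S -> 4 <= #|S|.
Proof.
move=> resS; pose A := [set P : T | inl P \in S].
pose B := [set z : circle | inr z \in S].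
have cS : #|S| = #|A| + #|B|.
  rewrite -sum1_card big_sumType /= !sum1_card.
  by congr (_ + _); apply: eq_card => x; rewrite inE.
(* Circles in [S] are at distance 2 from both [z] and [w], so only a point of [S] can separate them,
   and it does so by lying on exactly one of the two. *)
have trace_inj : {in ~: B &, injective (fun z : circle => val z :&: A)}.
  move=> z w; rewrite !inE => zB wB trace_zw; apply/eqP; apply: contraT => zw.
  move/forallP/(_ (inr z))/forallP/(_ (inr w))/implyP: resS.
  case/(_ zw)/existsP => -[P|x] /andP[sS]; last first.
    rewrite !gdist_circles ?eqxx //.
      by apply: contraNneq wB => ->.
    by apply: contraNneq zB => ->.
  rewrite !gdist_circle_point.
  by move/setP/(_ P): trace_zw; rewrite !inE sS !andbT => ->; rewrite eqxx.
have : #|~: B| <= 2 ^ #|A|.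
  rewrite -card_powerset -(card_in_imset trace_inj) subset_leq_card //.
  by apply/subsetP => _ /imsetP[z _ ->]; rewrite inE subsetIr.
have : #|B| + #|~: B| = 10.
  by rewrite cardsC card_sig card_circles_order2.
move=> cB traces; rewrite cS leqNgt; apply/negP => ltAB.
have {traces} : 10 <= #|B| + 2 ^ #|A| by rewrite -cB leq_add2l.
(* If a + b is at most 3, then b + 2 ^ a is at most 8, reached at a = 3, b = 0. *)
by move: ltAB; case: #|A| => [|[|[|[|a]]]]; case: #|B| => [|[|[|[|b]]]].
Qed.

(** A point other than [O] is separated from every other vertex by itself, at distance 0. What
    remains is to separate [O] from circles and circles from each other. *)
Lemma four_points_resolving_order2 (O : T) :
  resolving (@incidence T Z) [set inl P | P in ~: [set O]].
Proof.
have V1 : 1 < #|V| by rewrite card_incidence_vertex_order2.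
have sep (u v : V) : u != v -> dist u u != dist v u.
  move=> uv; rewrite (_ : dist u u = 0); first by rewrite eq_sym gdist_eq0 eq_sym.
  by apply/eqP; rewrite gdist_eq0.
have point_circle (P : T) (z : circle) :
    exists2 s : T, s != O & dist (inl P : V) (inl s) != dist (inr z : V) (inl s).
  have [PO|PO] := eqVneq P O; last first.
    by exists P => //; apply: sep.
  (* Any such [s] is at distance 1 from [z] but not from [O], since two points are never
     adjacent. *)
  have [s /setD1P[sO sz]] : exists s, s \in val z :\ O.
    apply/card_gt0P; have := cardsD1 O (val z); rewrite (h2 _ (valP z)).
    by case: #|val z :\ O| => //; case: (O \in _).
  exists s => //; rewrite gdist_circle_point sz.
  by rewrite gdist_eq1 //= andbF.
have resolve_by (u v : V) (s : T) : s != O ->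
    dist u (inl s) != dist v (inl s) ->
    [exists t in [set inl P | P in ~: [set O]] : {set V}, dist u t != dist v t].
  move=> sO duv; apply/existsP; exists (inl s); rewrite duv andbT.
  by apply/imsetP; exists s; rewrite ?inE.
apply/forallP => u; apply/forallP => v; apply/implyP.
case: u v => [P|z] [Q|w] uv.
- have [PO|PO] := eqVneq P O; last by apply: (resolve_by _ _ P) => //; apply: sep.
  apply: (resolve_by _ _ Q); first by rewrite -PO eq_sym.
  by rewrite eq_sym; apply: sep; rewrite eq_sym.
- by have [s sO] := point_circle P w; apply: resolve_by.
- have [s sO] := point_circle Q z; rewrite eq_sym.
  exact: resolve_by.
(* A circle has exactly three points, so its trace off O determines it. *)
have [s sO szw] : exists2 s, s != O & (s \in val z) != (s \in val w).
  apply/exists_inP; apply: contraT; rewrite negb_exists_in => /forall_inP eq_zw.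
  have eqD : val z :\ O = val w :\ O.
    apply/setP => s; rewrite !inE; case: eqVneq => //= /eq_zw.
    by rewrite negbK => /eqP.
  have eqO : (O \in val z) = (O \in val w).
    have := cardsD1 O (val z); rewrite eqD (h2 _ (valP z)) -(h2 _ (valP w)).
    by rewrite (cardsD1 O (val w)) => /addIn; do 2 case: (O \in _).
  case/negP: uv; apply/eqP; congr inr; apply/val_inj/setP => s.
  have [->|sO] := eqVneq s O; first exact: eqO.
  by have /setP/(_ s) := eqD; rewrite !inE sO.
apply: (resolve_by _ _ s sO); rewrite !gdist_circle_point.
by move: szw; case: (s \in val z); case: (s \in val w).
Qed.

End OrderTwo.

Theorem mainTheorem10 (T : finType) (Z : {set {set T}})
    (hM : mobius_plane Z) (h2 : mobius_order Z 2) :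
  metric_dimension (@incidence T Z) = 4.
Proof.
apply/metric_dimensionP; split; last by move=> S; apply: resolving_order2_ge4.
have [O _] : exists O : T, O \in T.
  by apply/card_gt0P; rewrite (card_points_order2 _ _ hM h2).
exists [set inl P | P in ~: [set O]]; first exact: four_points_resolving_order2.
rewrite card_imset; last by move=> P Q [].
by have := cardsC [set O]; rewrite cards1 (card_points_order2 _ _ hM h2) => -[].
Qed.
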